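(* Fix an integer $n>1$. The super vector space $\mathbb{C}[x_1,\ldots,x_n]\otimes\mathbb{C}^{1|2n}$ decomposes as an $\mathfrak{osp}(1|2n)$-module equal to the direct sum (of $\mathfrak{osp}(1|2n)$-submodules) $${}^{w_1}\Gamma\big(\mathbb{C}[x_1,\ldots,x_n]\otimes\mathbb{C}^{0|2n}\big)\ \oplus\ {}^{w_2}\Gamma\big(\mathbb{C}[x_1,\ldots,x_n]\otimes\mathbb{C}^{1|0}\big).$$
   Context: All vector spaces are over $\mathbb{C}$; $|\cdot|$ denotes parity in $\mathbb{Z}/2\mathbb{Z}$. $\mathbb{C}^{1|2n}$ has homogeneous basis $v_0$ (even), $v_1,\ldots,v_{2n}$ (odd); $\mathbb{C}^{1|0}=\mathbb{C}v_0$ and $\mathbb{C}^{0|2n}=\bigoplus_{i=1}^{2n}\mathbb{C}v_i$. The Lie superalgebra $\mathfrak{osp}(1|2n)\subset\mathfrak{gl}(1|2n)$ consists of the block matrices $\begin{bmatrix}0&r\\c&A\end{bmatrix}$ with $r=(r_1,\ldots,r_{2n})$, $c^{\intercal}=(r_{n+1},\ldots,r_{2n},-r_1,\ldots,-r_n)$, $A\in\mathfrak{sp}(2n)$, with the supercommutator bracket; $A$ gives the even part and $(r,c)$ the odd part. The inclusion is the natural representation $\tau$ on $\mathbb{C}^{1|2n}$. As a Lie superalgebra it is generated by the odd root vectors $X_{\pm j}$ ($1\le j\le n$), where $T_{\pm j}=\tau(X_{\pm j})$ acts by $T_jv_0=v_j$, $T_jv_{n+j}=v_0$, $T_{-j}v_0=-v_{n+j}$,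 $T_{-j}v_j=v_0$, and zero on all other basis vectors. The oscillator representation $\rho$ on $\mathbb{C}[x_1,\ldots,x_n]$ (parity of a monomial = its total degree mod 2) is determined by $\rho(X_j)=\tfrac1{\sqrt2}x_j$, $\rho(X_{-j})=\tfrac1{\sqrt2}\partial_{x_j}$. The tensor product representation $\rho\otimes\tau$ is $X(f\otimes v)=\rho(X)f\otimes v+(-1)^{|X||f|}f\otimes\tau(X)v$ for homogeneous $X,f$. The operators ${}^{w_1}\Gamma,{}^{w_2}\Gamma$ on $\mathbb{C}[x_1,\ldots,x_n]\otimes\mathbb{C}^{1|2n}$ are the linear automorphisms $${}^{w_1}\Gamma=\mathbf{1}\otimes\mathbf{1}-\sqrt2\sum_{i=1}^n\partial_{x_i}\otimes T_i+\sqrt2\sum_{i=1}^nx_i\otimes T_{-i},\qquad {}^{w_2}\Gamma=\mathbf{1}\otimes\mathbf{1}+\sqrt2\sum_{i=1}^n\partial_{x_i}\otimes T_i-\sqrt2\sum_{i=1}^nx_i\otimes T_{-i},$$ where, by the super sign rule, $(D\otimes T_{\pm i})(f\otimes v)=(-1)^{|f|}D(f)\otimes T_{\pm i}v$ for homogeneous $f$ and $D\in\{x_i,\partial_{x_i}\}$. *)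

(* Defs.v *)
From HB Require Import structures.
From mathcomp Require Import all_boot all_order all_algebra.
From mathcomp Require Import mpoly.
From mathcomp Require Import complex.
From mathcomp Require Import boolp classical_sets reals.
Set Implicit Arguments.
Unset Strict Implicit.
Unset Printing Implicit Defensive.
Import Order.TTheory GRing.Theory Num.Theory.
Local Open Scope classical_set_scope.
Local Open Scope ring_scope.

(* Parities in Z/2Z are booleans: [false] is even, [true] is odd, and addition
   is [(+)]. *)

(* The basis of C^{1|2n} is indexed by ['I_(1 + (n + n))]: [v0] is the even
   vector v_0, [vL j] is v_{1+j} and [vR j] is v_{n+1+j}, for [j : 'I_n]. *)
Section Indices.
Variable n : nat.
Definition v0 : 'I_(1 + (n + n)) := lshift (n + n) ord0.
Definition vL (j : 'I_n) : 'I_(1 + (n + n)) := rshift 1 (lshift n j).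
Definition vR (j : 'I_n) : 'I_(1 + (n + n)) := rshift 1 (rshift n j).
Definition vpar (a : 'I_(1 + (n + n))) : bool := a != v0.
End Indices.
Arguments v0 {n}.

Section LieSuperalgebra.
Variables (C : numClosedFieldType) (n : nat).
Implicit Types X Y : 'M[C]_(1 + (n + n)).

Definition even_part X : 'M[C]_(1 + (n + n)) :=
  block_mx (ulsubmx X) 0 0 (drsubmx X).
Definition odd_part X : 'M[C]_(1 + (n + n)) :=
  block_mx 0 (ursubmx X) (dlsubmx X) 0.

Definition gl_par (b : bool) : set 'M[C]_(1 + (n + n)) :=
  [set X | X = if b then odd_part X else even_part X].

(* The supercommutator, extended bilinearly from homogeneous matrices. *)
Definition sbracket X Y : 'M[C]_(1 + (n + n)) :=
  X *m Y - (even_part Y *m X + odd_part Y *m even_part X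
            - odd_part Y *m odd_part X).

Definition sympJ : 'M[C]_(n + n) := block_mx 0 1%:M (- 1%:M) 0.
Definition sp : set 'M[C]_(n + n) :=
  [set A | A^T *m sympJ + sympJ *m A = 0].

Definition osp : set 'M[C]_(1 + (n + n)) :=
  [set X | exists (r : 'rV[C]_(n + n)) (A : 'M[C]_(n + n)),
     sp A /\ X = block_mx 0 r (row_mx (rsubmx r) (- lsubmx r))^T A].

(* [delta_mx a b] sends the basis vector of index [b] to that of index [a].
   The natural representation being the inclusion, these matrices are at the
   same time X_{j}, X_{-j} and T_{j}, T_{-j}. *)
Definition Xpos (j : 'I_n) : 'M[C]_(1 + (n + n)) :=
  delta_mx (vL j) v0 + delta_mx v0 (vR j).
Definition Xneg (j : 'I_n) : 'M[C]_(1 + (n + n)) :=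
  - delta_mx (vR j) v0 + delta_mx v0 (vL j).

Section Modules.
Variables (V : lmodType C) (par : bool -> set V).

(* [par b] is the set of homogeneous vectors of parity [b] of [V]. The values
   of [act] outside [osp] are irrelevant. *)
Definition osp_rep (act : 'M[C]_(1 + (n + n)) -> V -> V) : Prop :=
  [/\ forall X, osp X -> linear (act X),
      forall a X Y u, osp X -> osp Y ->
        act (a *: X + Y) u = a *: act X u + act Y u,
      forall b c X u, osp X -> gl_par b X -> par c u -> par (b (+) c) (act X u) &
      forall b c X Y u, osp X -> osp Y -> gl_par b X -> gl_par c Y ->
        act (sbracket X Y) u =
          act X (act Y u) - (-1) ^+ (b && c) *: act Y (act X u)].

Definition subspace (W : set V) : Prop :=
  W 0 /\ forall a u v, W u -> W v -> W (a *: u + v).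

Definition graded (W : set V) : Prop :=
  forall u, W u -> exists u0 u1,
    [/\ W u0, W u1, par false u0, par true u1 & u = u0 + u1].

Definition osp_submodule (act : 'M[C]_(1 + (n + n)) -> V -> V) (W : set V) :=
  [/\ subspace W, graded W & forall X u, osp X -> W u -> W (act X u)].

Definition internal_direct_sum (W1 W2 : set V) : Prop :=
  (forall u, exists u1 u2, [/\ W1 u1, W2 u2 & u = u1 + u2]) /\
  W1 `&` W2 = [set 0].

End Modules.

Definition pol := {mpoly C[n]}.

Definition pol_par (b : bool) : set pol :=
  [set f | forall m, m \in msupp f -> odd (mdeg m) = b].

(* The linear map equal to (-1)^{|f|} f on homogeneous f. *)
Definition pol_sgn (f : pol) : pol :=
  \sum_(m <- msupp f) ((-1) ^+ mdeg m * f@_m) *: 'X_[m].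

Definition oscillator (rho : 'M[C]_(1 + (n + n)) -> pol -> pol) : Prop :=
  [/\ osp_rep pol_par rho,
      forall j f, rho (Xpos j) f = (sqrtC 2)^-1 *: ('X_j * f) &
      forall j f, rho (Xneg j) f = (sqrtC 2)^-1 *: f^`M(j)].

(* C[x_1..x_n] (x) C^{1|2n}, an element being given by its coordinates in
   C[x_1..x_n] along v_0, ..., v_{2n}; see [ptensor_universal]. *)
Definition tens := {ffun 'I_(1 + (n + n)) -> pol}.

Definition ptensor (f : pol) (v : 'cV[C]_(1 + (n + n))) : tens :=
  [ffun a => v a 0 *: f].

Definition tens_par (b : bool) : set tens :=
  [set u | forall a, pol_par (b (+) vpar a) (u a)].

(* The operator A (x) B for [B] of parity [p], with the super sign rule
   (A (x) B)(f (x) v) = (-1)^{p |f|} A f (x) B v; see [stensorE]. *)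
Definition stensor (p : bool) (A : pol -> pol) (B : 'M[C]_(1 + (n + n)))
    (u : tens) : tens :=
  [ffun b => \sum_a B b a *: A (if p then pol_sgn (u a) else u a)].

Definition tensor_act (rho : 'M[C]_(1 + (n + n)) -> pol -> pol)
    (X : 'M[C]_(1 + (n + n))) (u : tens) : tens :=
  stensor false (rho X) 1%:M u
  + (stensor false id (even_part X) u + stensor true id (odd_part X) u).

Definition Gamma1 (u : tens) : tens :=
  u - sqrtC 2 *: \sum_i stensor true (mderiv i) (Xpos i) u
    + sqrtC 2 *: \sum_i stensor true ( *%R 'X_i) (Xneg i) u.

Definition Gamma2 (u : tens) : tens :=
  u + sqrtC 2 *: \sum_i stensor true (mderiv i) (Xpos i) u
    - sqrtC 2 *: \sum_i stensor true ( *%R 'X_i) (Xneg i) u.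

(* C[x_1..x_n] (x) C^{1|0} and C[x_1..x_n] (x) C^{0|2n} *)
Definition tens_even_fiber : set tens := [set u | forall a, vpar a -> u a = 0].
Definition tens_odd_fiber : set tens := [set u | u v0 = 0].


Lemma pol_sgnE f m : (pol_sgn f)@_m = (-1) ^+ mdeg m * f@_m.
Proof.
rewrite /pol_sgn raddf_sum /=.
under eq_bigr do rewrite mcoeffZ mcoeffX.
have [fm|fm] := boolP (m \in msupp f).
  rewrite (bigD1_seq m) ?msupp_uniq //= eqxx mulr1 big1 ?addr0// => k.
  by move=> /negPf ->; rewrite mulr0.
rewrite (memN_msupp_eq0 fm) mulr0 big1_seq // => k /= kf.
by case: eqP kf fm => [->->//|]; rewrite mulr0.
Qed.

Lemma pol_sgn_linear : linear pol_sgn.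
Proof.
move=> a f g; apply/mpolyP => m.
by rewrite pol_sgnE !linearP /= !pol_sgnE mulrDr mulrCA.
Qed.

HB.instance Definition _ :=
  GRing.isLinear.Build C pol pol *:%R pol_sgn pol_sgn_linear.

Lemma pol_sgnK : involutive pol_sgn.
Proof. by move=> f; apply/mpolyP => m; rewrite !pol_sgnE mulrA -expr2 sqrr_sign mul1r. Qed.

Lemma pol_sgn_par b f : pol_par b f <-> pol_sgn f = (-1) ^+ b *: f.
Proof.
split=> [fb|/mpolyP fE m].
  apply/mpolyP => m; rewrite pol_sgnE mcoeffZ.
  have [/fb <-|fm] := boolP (m \in msupp f); first by rewrite signr_odd.
  by rewrite (memN_msupp_eq0 fm) !mulr0.
rewrite mcoeff_msupp => fm; have := fE m.
rewrite pol_sgnE mcoeffZ => /(mulIf fm).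
by rewrite -signr_odd; apply: signr_inj.
Qed.

Lemma stensorE p q (A : pol -> pol) B f v : linear A -> pol_par q f ->
  stensor p A B (ptensor f v) = (-1) ^+ (p && q) *: ptensor (A f) (B *m v).
Proof.
move=> linA fq; pose lA := GRing.isLinear.Build _ _ _ _ A linA.
pose A' : {linear pol -> pol} := HB.pack A lA.
have AE g : A g = A' g by [].
apply/ffunP => b; rewrite !ffunE mxE scaler_suml scaler_sumr.
apply: eq_bigr => a _; rewrite !ffunE.
have -> : (if p then pol_sgn (v a 0 *: f) else v a 0 *: f) =
    ((-1) ^+ (p && q) * v a 0) *: f.
  case: p => /=; last by rewrite mul1r.
  by rewrite linearZ /= (pol_sgn_par q f).1 // scalerA mulrC.
by rewrite !AE linearZ /= !scalerA mulrCA mulrA.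
Qed.

Lemma ptensor_universal (W : lmodType C)
    (bil : pol -> 'cV[C]_(1 + (n + n)) -> W) :
  (forall v, linear (bil^~ v)) -> (forall f, linear (bil f)) ->
  exists! phi : tens -> W,
    linear phi /\ forall f v, phi (ptensor f v) = bil f v.
Proof.
move=> lin1 lin2.
have bE f v : bil f v = \sum_a bil (v a 0 *: f) (delta_mx a 0).
  pose L1 v : {linear pol -> W} := HB.pack (bil^~ v)
    (GRing.isLinear.Build _ _ _ _ (bil^~ v) (lin1 v)).
  pose L2 : {linear 'cV[C]_(1 + (n + n)) -> W} := HB.pack (bil f)
    (GRing.isLinear.Build _ _ _ _ (bil f) (lin2 f)).
  transitivity (L2 v); first by [].
  rewrite {1}[v]matrix_sum_delta linear_sum; apply: eq_bigr => a _.
  rewrite big_ord1 linearZ /=.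
  by rewrite -[LHS]/(v a 0 *: L1 (delta_mx a 0) f) -linearZ.
have uE (u : tens) : u = \sum_a ptensor (u a) (delta_mx a 0).
  apply/ffunP => a; rewrite sum_ffunE (bigD1 a) //= big1 ?addr0.
    by rewrite ffunE mxE !eqxx scale1r.
  by move=> k ka; rewrite ffunE mxE eq_sym (negPf ka) scale0r.
exists (fun u : tens => \sum_a bil (u a) (delta_mx a 0)); split.
  split=> [a u v|f v]; last by rewrite bE; under eq_bigr do rewrite ffunE.
  rewrite scaler_sumr -big_split; apply: eq_bigr => k _ /=.
  by rewrite !ffunE; exact: lin1.
move=> psi [linpsi psiE]; apply/funext => u.
pose L : {linear tens -> W} := HB.pack psi
  (GRing.isLinear.Build _ _ _ _ psi linpsi).
rewrite -[psi u]/(L u) {2}[u]uE linear_sum; apply: eq_bigr => a _.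
by rewrite -[RHS]/(psi _) psiE.
Qed.


Lemma osp_coordP X :
  osp X <->
  [/\ X v0 v0 = 0,
      forall j, X (vL j) v0 = X v0 (vR j),
      forall j, X (vR j) v0 = - X v0 (vL j) &
      sp (drsubmx X)].
Proof.
rewrite /v0 /vL /vR; split=> [[r [A [spA ->]]]|[X0 XL XR spA]].
  split=> [|j|j|].
  - by rewrite block_mxEul mxE.
  - by rewrite block_mxEdl block_mxEur mxE row_mxEl mxE.
  - by rewrite block_mxEdl block_mxEur mxE row_mxEr !mxE.
  - by rewrite block_mxKdr.
exists (ursubmx X), (drsubmx X); split=> //.
rewrite -[LHS]submxK; congr block_mx; apply/matrixP => a b.
  by rewrite !mxE !ord1.
rewrite [RHS]mxE ord1 -[a]splitK; case: (split a) => k /=.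
  by rewrite row_mxEl !mxE XL.
by rewrite row_mxEr !mxE XR.
Qed.

Lemma Xpos_osp j : osp (Xpos j) /\ gl_par true (Xpos j).
Proof.
have eqR (a b : 'I_(n + n)) : (rshift 1 a == rshift 1 b) = (a == b).
  by rewrite (inj_eq (@rshift_inj _ _)).
have dr0 : drsubmx (Xpos j) = 0.
  by apply/matrixP => a b; rewrite !mxE /v0 !eq_rlshift andbF addr0.
split; last first.
  rewrite /gl_par /= /odd_part -[LHS]submxK dr0; congr block_mx.
  by apply/matrixP => a b; rewrite !mxE /v0 !eq_lrshift !andbF addr0.
apply/osp_coordP; split=> [|k|k|].
- by rewrite !mxE /v0 !eq_lrshift !andbF addr0.
- by rewrite !mxE /v0 !eqxx !eq_rlshift !eq_lrshift !eqR !eq_shift /= andbT addr0 add0r.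
- by rewrite !mxE /v0 !eqxx !eq_rlshift !eq_lrshift !eqR !eq_shift /= !addr0 oppr0.
- by rewrite dr0 /sp /= mulmx0 trmx0 mul0mx addr0.
Qed.

Lemma Xneg_osp j : osp (Xneg j) /\ gl_par true (Xneg j).
Proof.
have eqR (a b : 'I_(n + n)) : (rshift 1 a == rshift 1 b) = (a == b).
  by rewrite (inj_eq (@rshift_inj _ _)).
have dr0 : drsubmx (Xneg j) = 0.
  by apply/matrixP => a b; rewrite !mxE /v0 !eq_rlshift andbF oppr0 addr0.
split; last first.
  rewrite /gl_par /= /odd_part -[LHS]submxK dr0; congr block_mx.
  by apply/matrixP => a b; rewrite !mxE /v0 !eq_lrshift !andbF oppr0 addr0.
apply/osp_coordP; split=> [|k|k|].
- by rewrite !mxE /v0 !eq_lrshift !andbF oppr0 addr0.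
- by rewrite !mxE /v0 !eqxx !eq_rlshift !eq_lrshift !eqR !eq_shift /= oppr0 !addr0.
- by rewrite !mxE /v0 !eqxx !eq_rlshift !eq_lrshift !eqR !eq_shift /= andbT oppr0 addr0 add0r.
- by rewrite dr0 /sp /= mulmx0 trmx0 mul0mx addr0.
Qed.

Lemma linD (U V : lmodType C) (A : U -> V) : linear A -> {morph A : x y / x + y}.
Proof. by move=> linA x y; rewrite -[x in LHS]scale1r linA scale1r. Qed.

Lemma lin0 (U V : lmodType C) (A : U -> V) : linear A -> A 0 = 0.
Proof. by move=> linA; apply: (addrI (A 0)); rewrite -linD // !addr0. Qed.

Lemma linZ (U V : lmodType C) (A : U -> V) : linear A ->
  forall a x, A (a *: x) = a *: A x.
Proof. by move=> linA a x; rewrite -[_ *: x]addr0 linA lin0 // addr0. Qed.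

Lemma lin_sum (U V : lmodType C) (A : U -> V) (I : finType) (F : I -> U) (a : I -> C) :
  linear A -> A (\sum_i a i *: F i) = \sum_i a i *: A (F i).
Proof.
by move=> linA; elim/big_rec2: _ => [|i y x _ <-]; rewrite ?lin0 ?linA.
Qed.

Lemma stensor1E (A : pol -> pol) u k : stensor false A 1%:M u k = A (u k).
Proof.
rewrite ffunE (bigD1 k) //= big1 ?addr0 ?mxE ?eqxx ?scale1r // => a ak.
by rewrite mxE eq_sym (negPf ak) scale0r.
Qed.

Lemma odd_even_part X : even_part (odd_part X) = 0.
Proof. by rewrite /even_part block_mxKul block_mxKdr block_mx0. Qed.

Lemma even_odd_part X : odd_part (even_part X) = 0.
Proof. by rewrite /odd_part block_mxKur block_mxKdl block_mx0. Qed.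

Lemma stensor0 p A u : stensor p A 0 u = 0.
Proof.
by apply/ffunP => k; rewrite !ffunE big1 // => a _; rewrite mxE scale0r.
Qed.

Definition sgnb (b : bool) (f : pol) := if b then pol_sgn f else f.

Lemma sgnb_linear b : linear (sgnb b).
Proof. by case: b => a f g //=; rewrite /sgnb linearP. Qed.

HB.instance Definition _ b :=
  GRing.isLinear.Build C pol pol *:%R (sgnb b) (sgnb_linear b).

Lemma tensD (x y : tens) k : (x + y) k = x k + y k.
Proof. by rewrite ffunE. Qed.

Lemma tensB (x y : tens) a k : (x - a *: y) k = x k - a *: y k.
Proof. by rewrite !ffunE. Qed.

Lemma tensor_actE rho b X u k : gl_par b X ->
  tensor_act rho X u k = rho X (u k) + \sum_a X k a *: sgnb b (u a).
Proof.
rewrite /gl_par /= => XE; rewrite /tensor_act !tensD stensor1E.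
congr (_ + _); rewrite XE; case: b XE => _ /=.
  rewrite odd_even_part stensor0 ffunE add0r ffunE.
  by rewrite /odd_part block_mxKur block_mxKdl.
rewrite even_odd_part stensor0 [X in _ + X]ffunE addr0 ffunE.
by rewrite /even_part block_mxKul block_mxKdr.
Qed.

Lemma stensor_linear p A B : linear A -> linear (stensor p A B).
Proof.
move=> linA a u v; apply/ffunP => k; rewrite !ffunE scaler_sumr -big_split.
apply: eq_bigr => i _ /=; rewrite !ffunE.
have -> : (if p then pol_sgn (a *: u i + v i) else a *: u i + v i) =
    a *: (if p then pol_sgn (u i) else u i) + (if p then pol_sgn (v i) else v i).
  by case: p; rewrite ?linearP.
by rewrite linA scalerDr !scalerA [_ * a]mulrC.
Qed.

Lemma sgnb_comm b c f : sgnb b (sgnb c f) = sgnb (b (+) c) f.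
Proof. by case: b c => [] []; rewrite /sgnb //= pol_sgnK. Qed.

Lemma sgnb_par b q f : pol_par q f -> sgnb b f = (-1) ^+ (b && q) *: f.
Proof.
move=> fq; case: b => /=; last by rewrite scale1r.
by rewrite /sgnb (pol_sgn_par q f).1.
Qed.

Lemma pol_par_lin q a f g : pol_par q f -> pol_par q g -> pol_par q (a *: f + g).
Proof.
move=> /pol_sgn_par fq /pol_sgn_par gq; apply/pol_sgn_par.
by rewrite linearP /= fq gq scalerDr !scalerA mulrC.
Qed.

Lemma pol_par0 q : pol_par q 0.
Proof. by apply/pol_sgn_par; rewrite linear0 scaler0. Qed.

Lemma pol_par_sum q I (r : seq I) (F : I -> pol) :
  (forall i, pol_par q (F i)) -> pol_par q (\sum_(i <- r) F i).
Proof.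
move=> FP; elim/big_rec: _ => [|i f _ fP]; first exact: pol_par0.
by rewrite -[F i]scale1r; apply: pol_par_lin.
Qed.

Lemma pol_parZ q a f : pol_par q f -> pol_par q (a *: f).
Proof. by move=> fP; rewrite -[_ *: _]addr0; apply: pol_par_lin => //; exact: pol_par0. Qed.

Lemma pol_split f : exists f0 f1, [/\ pol_par false f0, pol_par true f1 & f = f0 + f1].
Proof.
exists (2^-1 *: (f + pol_sgn f)), (2^-1 *: (f - pol_sgn f)); split.
- by apply/pol_sgn_par; rewrite linearZ linearD /= pol_sgnK scale1r addrC.
- apply/pol_sgn_par; rewrite linearZ linearB /= pol_sgnK expr1.
  by rewrite scaleN1r -scalerN opprB.
- rewrite -scalerDr addrACA subrr addr0 -mulr2n -scaler_nat scalerA mulVf ?scale1r //.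
  by rewrite pnatr_eq0.
Qed.

Lemma gl_par_coord b X k l : gl_par b X -> X k l != 0 -> vpar k (+) vpar l = b.
Proof.
rewrite /gl_par /= /vpar /v0 => ->.
rewrite -[k]splitK -[l]splitK.
by case: b; case: (split k) (split l) => [k'|k'] [l'|l'] /=;
  rewrite /odd_part /even_part ?block_mxEul ?block_mxEur ?block_mxEdl ?block_mxEdr ?mxE
    ?ord1 ?eqxx ?eq_lrshift ?eq_rlshift //.
Qed.

Lemma gl_par_mul b c X Y :
  gl_par b X -> gl_par c Y -> gl_par (b (+) c) (X *m Y).
Proof.
rewrite /gl_par /= => -> ->.
by case: b c => [] []; rewrite /odd_part /even_part /= mulmx_block
  !(mulmx0, mul0mx, addr0, add0r) ?(block_mxKul, block_mxKur, block_mxKdl, block_mxKdr).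
Qed.

Lemma gl_par_lin b a X Y : gl_par b X -> gl_par b Y -> gl_par b (a *: X + Y).
Proof.
rewrite /gl_par /= => -> ->.
by case: b; rewrite /odd_part /even_part /= scale_block_mx add_block_mx
  !scaler0 !addr0 ?(block_mxKul, block_mxKur, block_mxKdl, block_mxKdr).
Qed.

Lemma sbracketE b c X Y : gl_par b X -> gl_par c Y ->
  sbracket X Y = X *m Y - (-1) ^+ (b && c) *: (Y *m X).
Proof.
rewrite /sbracket => XE YE.
have partE d Z : gl_par d Z -> even_part Z = (if d then 0 else Z) /\
    odd_part Z = (if d then Z else 0).
  by rewrite /gl_par /=; case: d => ZE; split; rewrite // ZE
    ?odd_even_part ?even_odd_part.
rewrite (partE _ _ YE).1 (partE _ _ YE).2 (partE _ _ XE).1 (partE _ _ XE).2.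
by case: b c {XE YE} => [] []; rewrite /= !(mulmx0, mul0mx) ?scale1r ?scaleN1r
  ?(addr0, add0r, sub0r, subr0, expr0, expr1).
Qed.

Lemma tensor_act_rep rho :
  osp_rep pol_par rho -> osp_rep tens_par (tensor_act rho).
Proof.
case=> rlin Xlin rpar rbr.
have rsgn b c X f : osp X -> gl_par b X ->
    rho X (sgnb c f) = (-1) ^+ (b && c) *: sgnb c (rho X f).
  move=> oX bX; have [f0 [f1 [f0P f1P ->]]] := pol_split f.
  have lX := rlin X oX.
  rewrite linearD /= (linD lX) (sgnb_par c f0P) (sgnb_par c f1P) (linD lX) !(linZ lX).
  rewrite linearD /= (sgnb_par c (rpar b false X f0 oX bX f0P)).
  rewrite (sgnb_par c (rpar b true X f1 oX bX f1P)).
  rewrite scalerDr !scalerA -!signr_addb; congr (_ *: _ + _ *: _); congr (_ ^+ (nat_of_bool _));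
  by case: b {bX} => //; case: c.
split.
- move=> X oX a u v; rewrite /tensor_act.
  have idl : linear (@id pol) by [].
  rewrite (stensor_linear _ _ (rlin X oX)) !(stensor_linear _ _ idl).
  by rewrite [X in _ + X = _]addrACA [LHS]addrACA !scalerDr.
- move=> a X Y u oX oY; rewrite /tensor_act.
  have evl : even_part (a *: X + Y) = a *: even_part X + even_part Y.
    rewrite /even_part scale_block_mx add_block_mx !scaler0 !addr0.
    by congr block_mx; apply/matrixP => i j; rewrite !mxE.
  have odl : odd_part (a *: X + Y) = a *: odd_part X + odd_part Y.
    rewrite /odd_part scale_block_mx add_block_mx !scaler0 !addr0.
    by congr block_mx; apply/matrixP => i j; rewrite !mxE.
  have sl p (Z T : 'M[C]_(1 + (n + n))) :
      stensor p id (a *: Z + T) u = a *: stensor p id Z u + stensor p id T u.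
    apply/ffunP => i; rewrite !ffunE scaler_sumr -big_split.
    by apply: eq_bigr => j _; rewrite !mxE scalerDl scalerA.
  have -> : stensor false (rho (a *: X + Y)) 1%:M u
      = a *: stensor false (rho X) 1%:M u + stensor false (rho Y) 1%:M u.
    by apply/ffunP => i; rewrite tensD [X in _ = X + _]ffunE !stensor1E Xlin.
  by rewrite evl odl !sl [X in _ + X = _]addrACA [LHS]addrACA !scalerDr.
- move=> b c X u oX bX uc k; rewrite (tensor_actE _ _ _ bX) -[rho X _]scale1r.
  apply: pol_par_lin; first by rewrite -addbA; apply: rpar.
  apply: pol_par_sum => a; have [->|Xka] := eqVneq (X k a) 0.
    by rewrite scale0r; exact: pol_par0.
  rewrite (sgnb_par b (uc a)); do 2!apply: pol_parZ.
  have <- : c (+) vpar a = b (+) c (+) vpar k; last exact: uc.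
  by rewrite -(gl_par_coord bX Xka); case: (vpar k) (vpar a) c {uc} => [] [] [].
- move=> b c X Y u oX oY bX cY; apply/ffunP => k.
  have bXY : gl_par (b (+) c) (sbracket X Y).
    rewrite (sbracketE bX cY) addrC -scaleNr; apply: gl_par_lin.
      by rewrite addbC; apply: gl_par_mul.
    exact: gl_par_mul.
  rewrite (tensor_actE _ _ _ bXY) tensB.
  have rsum Z : osp Z -> forall F : 'I_(1 + (n + n)) -> pol, forall a : 'I_(1 + (n + n)) -> C,
      rho Z (\sum_i a i *: F i) = \sum_i a i *: rho Z (F i).
    by move=> oZ F a; rewrite lin_sum //; apply: rlin.
  have rD Z f g : osp Z -> rho Z (f + g) = rho Z f + rho Z g.
    by move=> oZ; rewrite linD //; apply: rlin.
  have key (b' c' : bool) (X' Y' : 'M[C]_(1 + (n + n))) : osp X' -> osp Y' ->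
      gl_par b' X' -> gl_par c' Y' ->
    tensor_act rho X' (tensor_act rho Y' u) k =
      rho X' (rho Y' (u k)) +
      (\sum_a Y' k a *: ((-1) ^+ (b' && c') *: sgnb c' (rho X' (u a)))
       + \sum_a X' k a *: sgnb b' (rho Y' (u a))) +
      \sum_a (X' *m Y') k a *: sgnb (b' (+) c') (u a).
    move=> oX' oY' bX' cY'; rewrite (tensor_actE _ _ _ bX') (tensor_actE _ _ _ cY').
    rewrite rD // rsum // -!addrA; congr (_ + (_ + _)).
      by apply: eq_bigr => a _; rewrite (rsgn b').
    under eq_bigr do rewrite (tensor_actE _ _ _ cY') linearD scalerDr.
    rewrite big_split /=; congr (_ + _).
    under eq_bigr do rewrite linear_sum scaler_sumr.
    rewrite exchange_big; apply: eq_bigr => a _.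
    rewrite mxE scaler_suml; apply: eq_bigr => d _.
    by rewrite linearZ /= sgnb_comm scalerA.
  have kXY := key b c X Y oX oY bX cY; have kYX := key c b Y X oY oX cY bX.
  apply: (etrans _ (esym (congr2 (fun p q => p - (-1) ^+ (b && c) *: q) kXY kYX))).
  move=> {kXY kYX key} /=.
  rewrite (rbr _ _ _ _ _ oX oY bX cY).
  rewrite (sbracketE bX cY).
  have -> : \sum_a (X *m Y - (-1) ^+ (b && c) *: (Y *m X)) k a *: sgnb (b (+) c) (u a)
    = \sum_a (X *m Y) k a *: sgnb (b (+) c) (u a)
    - (-1) ^+ (b && c) *: \sum_a (Y *m X) k a *: sgnb (b (+) c) (u a).
    rewrite scaler_sumr -sumrB; apply: eq_bigr => a _.
    by rewrite 3!mxE scalerBl scalerA [in X in _ - X]mxE.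
  rewrite !scalerDr [c (+) b]addbC [c && b]andbC.
  set P := rho X _; set Q := _ *: rho Y _.
  set S1 := \sum_a (X *m Y) _ _ *: _; set S2 := _ *: \sum_a (Y *m X) _ _ *: _.
  have e1 : (-1) ^+ (b && c) *: (\sum_a X k a *: ((-1) ^+ (b && c) *: sgnb b (rho Y (u a))))
     = \sum_a X k a *: sgnb b (rho Y (u a)).
    rewrite scaler_sumr; apply: eq_bigr => a _.
    by rewrite !scalerA mulrC mulrA -expr2 sqrr_sign mul1r.
  have e2 : (-1) ^+ (b && c) *: (\sum_a Y k a *: sgnb c (rho X (u a)))
     = \sum_a Y k a *: ((-1) ^+ (b && c) *: sgnb c (rho X (u a))).
    by rewrite scaler_sumr; apply: eq_bigr => a _; rewrite !scalerA mulrC.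
  rewrite e1 e2; set A1 := \sum_a Y k a *: _; set B1 := \sum_a X k a *: _.
  rewrite opprD [RHS]addrACA; congr (_ + _).
  by rewrite opprD [RHS]addrACA [B1 + A1]addrC subrr addr0.
Qed.

(* The explicit oscillator representation: in terms of the operators
   q_a = (1/sqrt 2) d/dx_a, q_{n+a} = (1/sqrt 2) x_a, an odd matrix with first
   row r acts by \sum_a r_a q_a, and an even one A = J S (S symmetric) acts by
   \sum_{a,b} S_{ab} q_a q_b. *)
Definition osc_gen (a : 'I_(n + n)) (f : pol) : pol :=
  (sqrtC 2)^-1 *: match split a with
                  | inl j => f^`M(j)
                  | inr j => 'X_j * f
                  end.

Definition osc_lin (r : 'rV[C]_(n + n)) (f : pol) : pol :=
  \sum_a r 0 a *: osc_gen a f.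

Definition osc_quad (S : 'M[C]_(n + n)) (f : pol) : pol :=
  \sum_a \sum_b S a b *: osc_gen a (osc_gen b f).

Definition osc_rep X (f : pol) : pol :=
  osc_lin (ursubmx X) f + osc_quad (- sympJ *m drsubmx X) f.

Lemma osc_gen_linear a : linear (osc_gen a).
Proof.
move=> k f g; rewrite /osc_gen; case: (split a) => j.
  by rewrite mderivD mderivZ scalerDr !scalerA mulrC.
by rewrite mulrDr -scalerAr scalerDr !scalerA mulrC.
Qed.

HB.instance Definition _ a :=
  GRing.isLinear.Build C pol pol *:%R (osc_gen a) (osc_gen_linear a).

Lemma osc_lin_linear r : linear (osc_lin r).
Proof.
move=> k f g; rewrite /osc_lin scaler_sumr -big_split; apply: eq_bigr => a _ /=.
by rewrite linearP /= scalerDr scalerA mulrC -scalerA.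
Qed.

HB.instance Definition _ r :=
  GRing.isLinear.Build C pol pol *:%R (osc_lin r) (osc_lin_linear r).

Lemma osc_quad_linear S : linear (osc_quad S).
Proof.
move=> k f g; rewrite /osc_quad scaler_sumr -big_split; apply: eq_bigr => a _ /=.
rewrite scaler_sumr -big_split; apply: eq_bigr => b _ /=.
by rewrite (osc_gen_linear b) (osc_gen_linear a) scalerDr scalerA mulrC -scalerA.
Qed.

HB.instance Definition _ S :=
  GRing.isLinear.Build C pol pol *:%R (osc_quad S) (osc_quad_linear S).

Lemma osc_linDl k r s f : osc_lin (k *: r + s) f = k *: osc_lin r f + osc_lin s f.
Proof.
rewrite /osc_lin scaler_sumr -big_split; apply: eq_bigr => a _ /=.
by rewrite !mxE scalerDl scalerA.
Qed.

Lemma osc_quadDl k S T f : osc_quad (k *: S + T) f = k *: osc_quad S f + osc_quad T f.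
Proof.
rewrite /osc_quad scaler_sumr -big_split; apply: eq_bigr => a _ /=.
rewrite scaler_sumr -big_split; apply: eq_bigr => b _ /=.
by rewrite !mxE scalerDl scalerA.
Qed.

Lemma osc_lin0 f : osc_lin 0 f = 0.
Proof. by rewrite /osc_lin big1 // => a _; rewrite mxE scale0r. Qed.

Lemma osc_quad0 f : osc_quad 0 f = 0.
Proof. by rewrite /osc_quad big1 // => a _; rewrite big1 // => b _; rewrite mxE scale0r. Qed.

Lemma osc_ccr a b f :
  osc_gen a (osc_gen b f) = osc_gen b (osc_gen a f) + (2^-1 * sympJ a b) *: f.
Proof.
have s2 : (sqrtC 2)^-1 * (sqrtC 2)^-1 = 2^-1 :> C by rewrite -invfM -expr2 sqrtCK.
have e1 j k (g : pol) : mderiv j ('X_k * g) = 'X_k * mderiv j g + (j == k)%:R *: g.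
  rewrite mderivM mderivX mnm1E eq_sym addrC; congr (_ + _).
  rewrite -scalerAl; have [->|_] := eqVneq j k; last by rewrite !scale0r.
  rewrite (_ : (U_(k) - U_(k))%MM = 0%MM) ?mpolyX0 ?mul1r ?scale1r //.
  by apply/mnmP => l; rewrite mnmBE subnn mnm0E.
have e2 j (c : C) (g : pol) : 'X_j * (c *: g) = c *: ('X_j * g) by rewrite -scalerAr.
rewrite -[a]splitK -[b]splitK /osc_gen !unsplitK /sympJ.
case: (split a) (split b) => [j|j] [k|k] /=.
- by rewrite block_mxEul mxE mulr0 scale0r addr0 !mderivZ mderiv_comm.
- rewrite block_mxEur mxE !mderivZ e2 e1 !scalerDr !scalerA s2.
  by rewrite mulrA s2.
- rewrite block_mxEdl !mxE !mderivZ e2 e1 !scalerDr !scalerA s2 [k == j]eq_sym.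
  by rewrite mulrA s2 -addrA -scalerDl mulrN subrr scale0r addr0.
- by rewrite block_mxEdr mxE mulr0 scale0r addr0 !e2 mulrCA.
Qed.

Lemma osc_linNl r f : osc_lin (- r) f = - osc_lin r f.
Proof. by rewrite -scaleN1r -[_ *: _]addr0 osc_linDl osc_lin0 addr0 scaleN1r. Qed.

Lemma osc_lin_lin r s f : osc_lin r (osc_lin s f) = osc_quad (r^T *m s) f.
Proof.
rewrite /osc_lin /osc_quad; apply: eq_bigr => a _; rewrite linear_sum scaler_sumr.
apply: eq_bigr => b _ /=.
by rewrite (linZ (osc_gen_linear a)) scalerA !mxE big_ord1 !mxE.
Qed.

Lemma osc_quad_gen S c f : S^T = S ->
  osc_quad S (osc_gen c f) =
  osc_gen c (osc_quad S f) + \sum_a (S *m sympJ) a c *: osc_gen a f.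
Proof.
move=> symS.
have SE a b : S a b = S b a by rewrite -[in LHS]symS mxE.
have half : \sum_a \sum_b S a b *: ((2^-1 * sympJ b c) *: osc_gen a f) =
    2^-1 *: \sum_a (S *m sympJ) a c *: osc_gen a f.
  rewrite scaler_sumr; apply: eq_bigr => a _.
  rewrite mxE scaler_suml scaler_sumr; apply: eq_bigr => b _.
  by rewrite !scalerA mulrCA.
have -> : \sum_a (S *m sympJ) a c *: osc_gen a f =
    \sum_a \sum_b S a b *: ((2^-1 * sympJ b c) *: osc_gen a f) +
    \sum_a \sum_b S a b *: ((2^-1 * sympJ a c) *: osc_gen b f).
  have -> : \sum_a \sum_b S a b *: ((2^-1 * sympJ a c) *: osc_gen b f) =
    \sum_a \sum_b S a b *: ((2^-1 * sympJ b c) *: osc_gen a f).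
    rewrite exchange_big; apply: eq_bigr => a _; apply: eq_bigr => b _.
    by rewrite SE.
  rewrite half -scalerDl (_ : 2^-1 + 2^-1 = 1) ?scale1r //.
  by rewrite -mulr2n -(mulr_natr 2^-1) mulVf // pnatr_eq0.
rewrite /osc_quad linear_sum -!big_split; apply: eq_bigr => a _.
rewrite linear_sum -!big_split; apply: eq_bigr => b _ /=.
rewrite (linZ (osc_gen_linear c)) [osc_gen b (osc_gen c f)]osc_ccr.
rewrite (linD (osc_gen_linear a) (osc_gen c _)) (linZ (osc_gen_linear a) (_ * _)).
rewrite (osc_ccr a c) !scalerDr.
by rewrite addrAC addrA.
Qed.

Lemma osc_quad_lin S r f : S^T = S ->
  osc_quad S (osc_lin r f) =
  osc_lin r (osc_quad S f) + osc_lin (r *m (S *m sympJ)^T) f.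
Proof.
move=> symS; rewrite {1}/osc_lin (lin_sum _ _ (osc_quad_linear S)).
under eq_bigr => c _ do rewrite (osc_quad_gen c) // scalerDr.
rewrite big_split; congr (_ + _) => /=.
under eq_bigr do rewrite scaler_sumr.
rewrite exchange_big; apply: eq_bigr => a _ /=.
rewrite [in RHS]mxE scaler_suml; apply: eq_bigr => c _.
by rewrite scalerA [(_^T) _ _]mxE.
Qed.

Lemma osc_quad_quad S T f : S^T = S ->
  osc_quad S (osc_quad T f) =
  osc_quad T (osc_quad S f) + osc_quad (S *m sympJ *m T + T *m (S *m sympJ)^T) f.
Proof.
move=> symS; rewrite -[X in osc_quad (X + _)]scale1r osc_quadDl scale1r.
rewrite {2}/osc_quad.
rewrite (big_morph _ (linD (osc_quad_linear S)) (lin0 (osc_quad_linear S))).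
under eq_bigr => c _.
  rewrite (lin_sum _ _ (osc_quad_linear S)).
  under eq_bigr => d _.
    rewrite (osc_quad_gen c) // (osc_quad_gen d) //.
    rewrite (linD (osc_gen_linear c) (osc_gen d _)) !scalerDr.
  over.
  rewrite !big_split /=.
over.
rewrite !big_split /= -addrA; congr (_ + _); rewrite addrC; congr (_ + _).
  rewrite /osc_quad.
  under eq_bigr do under eq_bigr do rewrite scaler_sumr.
  under eq_bigr do rewrite exchange_big /=.
  rewrite exchange_big; apply: eq_bigr => a _ /=.
  rewrite exchange_big; apply: eq_bigr => d _ /=.
  rewrite [in RHS]mxE scaler_suml; apply: eq_bigr => c _.
  by rewrite scalerA mulrC.
rewrite /osc_quad; apply: eq_bigr => c _.
under eq_bigr do rewrite linear_sum scaler_sumr.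
rewrite exchange_big; apply: eq_bigr => a _ /=.
rewrite [in RHS]mxE scaler_suml; apply: eq_bigr => d _.
by rewrite (linZ (osc_gen_linear c)) scalerA [(_^T) _ _]mxE.
Qed.

Lemma sympJK : sympJ *m sympJ = - 1%:M :> 'M[C]_(n + n).
Proof.
rewrite /sympJ mulmx_block !(mulmx0, mul0mx, mulmxN, mulmx1, mulNmx, addr0, add0r).
by rewrite [in RHS]scalar_mx_block opp_block_mx !oppr0.
Qed.

Lemma sympJT : sympJ^T = - sympJ :> 'M[C]_(n + n).
Proof.
rewrite /sympJ tr_block_mx opp_block_mx !oppr0 opprK !trmx0.
by rewrite linearN /= trmx1.
Qed.

Lemma osp_blockE X : osp X ->
  X = block_mx 0 (ursubmx X) (sympJ *m (ursubmx X)^T) (drsubmx X) /\ sp (drsubmx X).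
Proof.
move=> [r [A [spA ->]]]; rewrite block_mxKur block_mxKdr; split=> //.
congr block_mx.
have -> : r^T = col_mx (lsubmx r)^T (rsubmx r)^T by rewrite -tr_row_mx hsubmxK.
rewrite /sympJ mul_block_col tr_row_mx linearN /=.
by rewrite !mul0mx mul1mx mulNmx mul1mx add0r addr0.
Qed.

Lemma sp_sym A : sp A -> (- sympJ *m A)^T = - sympJ *m A.
Proof.
rewrite /sp /= => /eqP; rewrite addr_eq0 => /eqP e.
by rewrite trmx_mul linearN /= sympJT opprK e mulNmx.
Qed.

Lemma sp_symJ A : sp A -> (- sympJ *m A *m sympJ)^T = - A.
Proof.
move=> spA; rewrite trmx_mul sp_sym // sympJT mulmxA mulNmx mulmxN opprK sympJK.
by rewrite mulNmx mul1mx.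
Qed.

Lemma osc_gen_par a q f : pol_par q f -> pol_par (~~ q) (osc_gen a f).
Proof.
move=> fq; apply: pol_parZ; case: (split a) => j m.
  rewrite mcoeff_msupp mcoeff_deriv => /negPf mN.
  have : (m + U_(j))%MM \in msupp f.
    by rewrite mcoeff_msupp; apply: contraFN mN => /eqP ->; rewrite mul0rn.
  by move=> /fq <-; rewrite mdegD mdeg1 addn1 /= negbK.
rewrite mulrC (perm_mem (msuppMX _ _)) => /mapP[m' /fq <- ->].
by rewrite mdegD mdeg1.
Qed.

Lemma osc_lin_par r q f : pol_par q f -> pol_par (~~ q) (osc_lin r f).
Proof. by move=> fq; apply: pol_par_sum => a; apply/pol_parZ/osc_gen_par. Qed.

Lemma osc_quad_par S q f : pol_par q f -> pol_par q (osc_quad S f).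
Proof.
move=> fq; do 2!apply: pol_par_sum => ?; apply: pol_parZ.
by rewrite -[q]negbK; do 2!apply: osc_gen_par.
Qed.

Lemma osc_homog b X f : gl_par b X ->
  osc_rep X f = if b then osc_lin (ursubmx X) f else osc_quad (- sympJ *m drsubmx X) f.
Proof.
rewrite /gl_par /osc_rep /= => ->; case: b; rewrite /odd_part /even_part.
  by rewrite block_mxKur block_mxKdr mulmx0 osc_quad0 addr0.
by rewrite block_mxKur block_mxKdr osc_lin0 add0r.
Qed.

Lemma oscillator_exists : exists rho, oscillator rho.
Proof.
exists osc_rep; split; last 2 first.
- move=> j f; have [_ /osc_homog ->] := Xpos_osp j.
  rewrite /osc_lin (bigD1 (rshift n j)) //= big1 ?addr0 => [|a aj].
    rewrite !mxE /v0 !eqxx eq_lrshift /= add0r scale1r /osc_gen.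
    by rewrite -[rshift n j]/(unsplit (inr j)) unsplitK.
  by rewrite !mxE /v0 eq_lrshift (inj_eq (@rshift_inj _ _)) (negPf aj) andbF addr0 scale0r.
- move=> j f; have [_ /osc_homog ->] := Xneg_osp j.
  rewrite /osc_lin (bigD1 (lshift n j)) //= big1 ?addr0 => [|a aj].
    rewrite !mxE /v0 !eqxx eq_lrshift /= oppr0 add0r scale1r /osc_gen.
    by rewrite -[lshift n j]/(unsplit (inl j)) unsplitK.
  by rewrite !mxE /v0 eq_lrshift (inj_eq (@rshift_inj _ _)) (negPf aj) andbF oppr0 addr0 scale0r.
split.
- move=> X _ k f g; rewrite /osc_rep !linearP /= scalerDr.
  by rewrite addrACA.
- move=> k X Y f _ _; rewrite /osc_rep.
  have -> : ursubmx (k *: X + Y) = k *: ursubmx X + ursubmx Y.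
    by apply/matrixP => i j; rewrite !mxE.
  have -> : drsubmx (k *: X + Y) = k *: drsubmx X + drsubmx Y.
    by apply/matrixP => i j; rewrite !mxE.
  by rewrite mulmxDr -scalemxAr osc_linDl osc_quadDl scalerDr addrACA.
- move=> b c X f _ bX fc; rewrite (osc_homog _ bX); case: b {bX} => /=.
    exact: osc_lin_par.
  exact: osc_quad_par.
move=> b c X Y f /osp_blockE[XE spA] /osp_blockE[YE spB] bX cY.
have bXY : gl_par (b (+) c) (sbracket X Y).
  rewrite (sbracketE bX cY) addrC -scaleNr; apply: gl_par_lin.
    by rewrite addbC; apply: gl_par_mul.
  exact: gl_par_mul.
rewrite (osc_homog _ bX) (osc_homog _ cY) (osc_homog _ bXY) (sbracketE bX cY).
rewrite (osc_homog _ bX) (osc_homog _ cY).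
have ez d Z : gl_par d Z -> if d then drsubmx Z = 0 else ursubmx Z = 0.
  by rewrite /gl_par /=; case: d => ->; rewrite /odd_part /even_part ?block_mxKdr ?block_mxKur.
have := ez _ _ bX; have := ez _ _ cY.
set r := ursubmx X in XE *; set s := ursubmx Y in YE *.
set A := drsubmx X in XE spA *; set B := drsubmx Y in YE spB *.
rewrite XE YE !mulmx_block !(mul0mx, add0r).
rewrite scale_block_mx opp_block_mx add_block_mx block_mxKur block_mxKdr.
case: b c {bX cY bXY} => [] [] /= eB eA; rewrite ?eA ?eB ?expr0 ?expr1 ?scale1r ?scaleN1r
  ?(mul0mx, mulmx0, addr0, add0r, opprK, oppr0, subr0, sub0r, trmx0).
- rewrite !osc_lin_lin mulmxDr !mulmxA !mulNmx sympJK !mulNmx !opprK !mul1mx.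
  by rewrite -[X in osc_quad (X + _)]scale1r osc_quadDl scale1r.
- rewrite osc_quad_lin ?sp_sym // sp_symJ // mulmxN osc_linNl opprD opprK.
  by rewrite addrA subrr add0r.
- rewrite osc_quad_lin ?sp_sym // sp_symJ // mulmxN.
  by rewrite [RHS]addrC addKr.
- rewrite osc_quad_quad ?sp_sym // sp_symJ // [RHS]addrC addKr.
  congr (osc_quad _ f).
  rewrite mulmxBr !mulmxA; congr (_ + _).
    by rewrite -[_ *m sympJ *m - sympJ]mulmxA mulmxN sympJK opprK mulmx1.
  by rewrite mulmxN.
Qed.

End LieSuperalgebra.

(* Main.v *)
(* Write q_a for the oscillator operators (d/dx_i and x_i divided by sqrt 2) and
   J for the symplectic matrix, so that [q_a, q_b] = J_ab / 2.  In coordinates,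
   with s f = (-1)^|f| f, the image of Gamma1 is the graph
     u_0 = -2 \sum_(a,b) J_ab q_a s u_b
   and the image of Gamma2 is the graph u_a = 2 q_a s u_0.  Both graphs are
   stable under the odd generators of osp(1|2n) by the commutation relations,
   hence under osp(1|2n), whose even part is spanned by brackets of odd elements.
   Substituting the second equation in the first gives u_0 = 2n u_0, so the
   graphs are complementary because 2n is not 1. *)
Require Import Defs.
From HB Require Import structures.
From mathcomp Require Import all_boot all_order all_algebra.
From mathcomp Require Import mpoly.
From mathcomp Require Import complex.
From mathcomp Require Import ring.
From mathcomp Require Import boolp classical_sets reals.
Set Implicit Arguments.
Unset Strict Implicit.
Unset Printing Implicit Defensive.
Import Order.TTheory GRing.Theory Num.Theory.
Local Open Scope classical_set_scope.
Local Open Scope ring_scope.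

(** * Odd elements of osp(1|2n) and a criterion for invariant subspaces *)

Section OddGenerators.
Variables (C : numClosedFieldType) (n : nat).
Local Notation J := (sympJ C n).
Implicit Types (r s : 'rV[C]_(n + n)) (A S : 'M[C]_(n + n)).

Lemma osp_block r A : sp A -> osp (block_mx 0 r (J *m r^T) A).
Proof.
move=> spA; exists r, A; split=> //; congr block_mx.
have -> : r^T = col_mx (lsubmx r)^T (rsubmx r)^T by rewrite -tr_row_mx hsubmxK.
rewrite /sympJ mul_block_col tr_row_mx linearN /=.
by rewrite !mul0mx mul1mx mulNmx mul1mx add0r addr0.
Qed.

Lemma sp0 : sp (0 : 'M[C]_(n + n)).
Proof. by rewrite /sp /= trmx0 mul0mx mulmx0 addr0. Qed.

Lemma sp_lin a A B : sp A -> sp B -> sp (a *: A + B :> 'M[C]_(n + n)).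
Proof.
rewrite /sp /= => spA spB; rewrite linearP /= mulmxDl mulmxDr -scalemxAl -scalemxAr.
by rewrite addrACA -scalerDr spA spB scaler0 addr0.
Qed.

(** Converse of [sp_sym]: since J^2 = -1, multiplication by J identifies symmetric matrices with
    sp(2n). *)
Lemma sp_sympJM S : S^T = S -> sp (J *m S).
Proof.
move=> symS; rewrite /sp /= trmx_mul symS sympJT mulmxN mulNmx mulmxA sympJK.
by rewrite -mulmxA sympJK mulmxN mulNmx opprK mulmx1 mul1mx subrr.
Qed.

Lemma osp_lin a (X Y : 'M[C]_(1 + (n + n))) : osp X -> osp Y -> osp (a *: X + Y).
Proof.
move=> /osp_blockE[-> +] /osp_blockE[-> +]; rewrite !block_mxKdr.
move: (ursubmx X) (drsubmx X) (ursubmx Y) (drsubmx Y) => r A s B spA spB.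
rewrite scale_block_mx add_block_mx scaler0 addr0 scalemxAr -mulmxDr -linearP.
exact/osp_block/sp_lin.
Qed.

(** Writing the column as J r^T, rather than by swapped halves of r, turns brackets into matrix
    products with J. *)
Definition odd_osp r : 'M[C]_(1 + (n + n)) := block_mx 0 r (J *m r^T) 0.

Lemma odd_osp_osp r : osp (odd_osp r).
Proof. exact/osp_block/sp0. Qed.

Lemma odd_osp_par r : gl_par true (odd_osp r).
Proof. by rewrite /gl_par /= /odd_part block_mxKur block_mxKdl. Qed.

Lemma odd_osp_lin a r s : odd_osp (a *: r + s) = a *: odd_osp r + odd_osp s.
Proof.
rewrite /odd_osp scale_block_mx add_block_mx !scaler0 !addr0.
by rewrite linearP /= mulmxDr -scalemxAr.
Qed.

Lemma sbracket_odd_osp r s :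
  sbracket (odd_osp r) (odd_osp s) = block_mx 0 0 0 (J *m (r^T *m s + s^T *m r)).
Proof.
rewrite (sbracketE (odd_osp_par r) (odd_osp_par s)) expr1 scaleN1r opprK.
rewrite /odd_osp !mulmx_block !(mul0mx, mulmx0, addr0, add0r) add_block_mx !addr0.
rewrite -!mulmxA -mulmxDr; congr block_mx.
(* A 1 x 1 matrix is its own transpose, so antisymmetry of J cancels the two terms of the scalar
   block. *)
have -> : s *m (J *m r^T) = (s *m (J *m r^T))^T.
  by apply/matrixP => i j; rewrite !ord1 [RHS]mxE.
by rewrite !trmx_mul trmxK sympJT mulmxN mulNmx mulmxA subrr.
Qed.

Lemma Xneg_odd_osp j : Xneg C j = odd_osp (delta_mx 0 (lshift n j)).
Proof.
have [/osp_blockE[XE _] gX] := Xneg_osp C j.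
rewrite XE /odd_osp; have <- : ursubmx (Xneg C j) = delta_mx 0 (lshift n j).
  apply/matrixP => a b; rewrite !mxE /v0 !ord1 !eqxx eq_lrshift /= oppr0 add0r.
  by rewrite (inj_eq (@rshift_inj _ _)).
by congr block_mx; rewrite gX /odd_part block_mxKdr.
Qed.

Lemma Xpos_odd_osp j : Xpos C j = odd_osp (delta_mx 0 (rshift n j)).
Proof.
have [/osp_blockE[XE _] gX] := Xpos_osp C j.
rewrite XE /odd_osp; have <- : ursubmx (Xpos C j) = delta_mx 0 (rshift n j).
  apply/matrixP => a b; rewrite !mxE /v0 !ord1 !eqxx eq_lrshift /= add0r.
  by rewrite (inj_eq (@rshift_inj _ _)).
by congr block_mx; rewrite gX /odd_part block_mxKdr.
Qed.

Variables (V : lmodType C) (par : bool -> set V).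
Variables (act : 'M[C]_(1 + (n + n)) -> V -> V) (W : set V).

(** On a bracket of odd X, Y the action is XY + YX, which preserves W as soon as X and Y do; such
    brackets span the even part. *)
Lemma osp_invariant_odd :
  osp_rep par act -> subspace W ->
  (forall a u, W u -> W (act (odd_osp (delta_mx 0 a)) u)) ->
  forall X u, osp X -> W u -> W (act X u).
Proof.
move=> [_ actD _ act_br] [W0 Wlin] Wgen.
pose P X := osp X /\ forall u, W u -> W (act X u).
have P0 : P 0.
  have o0 : osp (0 : 'M[C]_(1 + (n + n))).
    by have := odd_osp_osp 0; rewrite /odd_osp trmx0 mulmx0 block_mx0.
  split=> // u _; have := actD (-1) 0 0 u o0 o0.
  by rewrite scaler0 addr0 scaleN1r addNr => ->.
have Plin k X Y : P X -> P Y -> P (k *: X + Y).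
  move=> [oX WX] [oY WY]; split=> [|u Wu]; first exact: osp_lin.
  by rewrite actD //; apply: Wlin; [apply: WX|apply: WY].
have Podd r : P (odd_osp r).
  suff: P (\sum_a r 0 a *: odd_osp (delta_mx 0 a)).
    rewrite -(lin_sum (A := odd_osp)); last exact: odd_osp_lin.
    by rewrite -row_sum_delta.
  elim/big_rec: _ => // a X _; apply: Plin; split; first exact: odd_osp_osp.
  exact: Wgen.
have Pbr r s : P (sbracket (odd_osp r) (odd_osp s)).
  split=> [|u Wu].
    rewrite sbracket_odd_osp; have := @osp_block 0 (J *m (r^T *m s + s^T *m r)).
    rewrite trmx0 mulmx0; apply; apply: sp_sympJM.
    by rewrite linearD /= !trmx_mul !trmxK addrC.
  rewrite (act_br true true _ _ _ (odd_osp_osp r) (odd_osp_osp s)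
    (odd_osp_par r) (odd_osp_par s)).
  rewrite addrC -scaleNr; apply: Wlin; do 2 (apply: (Podd _).2 => //).
move=> X u oX; suff /(_ u) : forall u, W u -> W (act X u) by [].
suff /(_ X oX)[] : forall X, osp X -> P X by [].
move=> {X oX u}X /osp_blockE[-> +]; rewrite block_mxKdr.
move: (ursubmx X) (drsubmx X) => r A spA.
pose S := - J *m A.
(* Polarize the symmetric matrix [S = -J A]. *)
have -> : block_mx 0 r (J *m r^T) A = 1 *: odd_osp r +
    \sum_a 2^-1 *: sbracket (odd_osp (delta_mx 0 a)) (odd_osp (row a S)).
  have blk0 : linear (fun B : 'M[C]_(n + n) => block_mx 0 0 0 B : 'M[C]_(1 + (n + n))).
    by move=> k B B'; rewrite scale_block_mx add_block_mx !scaler0 !addr0.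
  under eq_bigr do rewrite sbracket_odd_osp.
  rewrite -(lin_sum _ _ blk0) scale1r /odd_osp add_block_mx !addr0 add0r.
  congr block_mx; under eq_bigr do rewrite scalemxAr.
  rewrite -mulmx_sumr -scaler_sumr.
  (* The brackets contribute this sum and its transpose; S being symmetric, both equal S, whence the
     factor 1/2. *)
  have SE : S = \sum_a (delta_mx 0 a)^T *m row a S.
    apply/matrixP => i j; rewrite summxE (bigD1 i) //= big1 ?addr0 => [|a ai].
      by rewrite [RHS]mxE big_ord1 [row _ _ _ _]mxE !mxE !eqxx mul1r.
    by rewrite mxE big_ord1 !mxE eqxx eq_sym (negPf ai) mul0r.
  rewrite big_split /= -SE.
  have -> : \sum_a (row a S)^T *m delta_mx 0 a = S.
    rewrite -[RHS](sp_sym spA) -/S [in RHS]SE linear_sum.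
    by apply: eq_bigr => a _ /=; rewrite trmx_mul trmxK.
  rewrite -mulr2n -(scaler_nat 2) scalerA mulVf ?pnatr_eq0 // scale1r.
  by rewrite /S mulmxA mulmxN sympJK opprK mul1mx.
apply: (Plin) => //; elim/big_rec: _ => // a X' _; exact: Plin.
Qed.

End OddGenerators.

(** * Sign operator, symplectic form and contraction with the oscillator operators *)

Section Gamma.
Variables (C : numClosedFieldType) (n : nat).
Local Notation J := (sympJ C n).
Local Notation vodd := (@rshift 1 (n + n)).
Local Notation W1 := (@Gamma1 C n @` @tens_odd_fiber C n).
Local Notation W2 := (@Gamma2 C n @` @tens_even_fiber C n).
Implicit Types (f : pol C n) (u : tens C n) (a b c d : 'I_(n + n)).

Lemma split_v0_vodd (k : 'I_(1 + (n + n))) : k = v0 \/ exists a, k = vodd a.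
Proof.
by rewrite -[k]splitK; case: (split k) => [i|a]; [left; rewrite ord1|right; exists a].
Qed.

(** Each q_a reverses the parity of the degree; check on homogeneous f and split the general one. *)
Lemma pol_sgn_osc_gen a f : pol_sgn (osc_gen a f) = - osc_gen a (pol_sgn f).
Proof.
have sgn_par q (g : pol C n) : pol_par q g -> pol_sgn (osc_gen a g) = - osc_gen a (pol_sgn g).
  move=> gq; rewrite ((pol_sgn_par (~~ q) _).1 (osc_gen_par gq)).
  by rewrite ((pol_sgn_par q g).1 gq) (linZ (osc_gen_linear a)) signrN scaleNr.
have [f0 [f1 [f0P f1P ->]]] := pol_split f.
rewrite (linD (osc_gen_linear a)) !(linD (@pol_sgn_linear C n)) (linD (osc_gen_linear a)).
by rewrite (sgn_par _ _ f0P) (sgn_par _ _ f1P) opprD.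
Qed.

Lemma sympJ_LL (i j : 'I_n) : J (lshift n i) (lshift n j) = 0.
Proof. by rewrite /sympJ block_mxEul mxE. Qed.

Lemma sympJ_LR (i j : 'I_n) : J (lshift n i) (rshift n j) = (i == j)%:R.
Proof. by rewrite /sympJ block_mxEur mxE. Qed.

Lemma sympJ_RL (i j : 'I_n) : J (rshift n i) (lshift n j) = - (i == j)%:R.
Proof. by rewrite /sympJ block_mxEdl !mxE. Qed.

Lemma sympJ_RR (i j : 'I_n) : J (rshift n i) (rshift n j) = 0.
Proof. by rewrite /sympJ block_mxEdr mxE. Qed.

Lemma sum_sympJ_sympJ a b : \sum_c J c a * J c b = (a == b)%:R.
Proof.
have /matrixP/(_ a b) : J^T *m J = 1%:M by rewrite sympJT mulNmx sympJK opprK.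
rewrite [(_ *m _) a b]mxE [1%:M a b]mxE => <-.
by apply: eq_bigr => c _; rewrite [J^T _ _]mxE.
Qed.

Lemma odd_osp_sum_v0 a (F : 'I_(1 + (n + n)) -> pol C n) :
  \sum_k odd_osp (delta_mx 0 a) v0 k *: F k = F (vodd a).
Proof.
rewrite big_split_ord big_ord1 /= /odd_osp /v0 block_mxEul mxE scale0r add0r.
rewrite (bigD1 a) //= big1 => [|b ba]; rewrite block_mxEur mxE.
  by rewrite !eqxx scale1r addr0.
by rewrite (negPf ba) andbF scale0r.
Qed.

Lemma odd_osp_sum_vodd a b (F : 'I_(1 + (n + n)) -> pol C n) :
  \sum_k odd_osp (delta_mx 0 a) (vodd b) k *: F k = J b a *: F v0.
Proof.
rewrite big_split_ord big_ord1 /= /odd_osp /v0 block_mxEdl [X in _ + X]big1.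
  by rewrite addr0 trmx_delta -colE mxE.
by move=> c _; rewrite block_mxEdr mxE scale0r.
Qed.

(** Contraction of w with the operators q_a by the symplectic form; the equation of the image of
    [Gamma1] is written with it. *)
Definition osc_pairing (w : 'I_(n + n) -> pol C n) : pol C n :=
  \sum_a \sum_b J a b *: osc_gen a (w b).

Lemma osc_pairingE w : osc_pairing w =
  \sum_i osc_gen (lshift n i) (w (rshift n i))
  - \sum_i osc_gen (rshift n i) (w (lshift n i)).
Proof.
rewrite /osc_pairing big_split_ord -sumrN /=; congr (_ + _); apply: eq_bigr => i _.
  rewrite big_split_ord /= [X in X + _]big1 => [|j _]; last by rewrite sympJ_LL scale0r.
  rewrite add0r (bigD1 i) //= big1 => [|j ji]; rewrite sympJ_LR.
    by rewrite eqxx scale1r addr0.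
  by rewrite eq_sym (negPf ji) scale0r.
rewrite big_split_ord /= [X in _ + X]big1 => [|j _]; last by rewrite sympJ_RR scale0r.
rewrite addr0 (bigD1 i) //= big1 => [|j ji]; rewrite sympJ_RL.
  by rewrite eqxx scaleN1r addr0.
by rewrite eq_sym (negPf ji) oppr0 scale0r.
Qed.

Lemma osc_pairing_lin k w w' :
  osc_pairing (fun a => k *: w a + w' a) = k *: osc_pairing w + osc_pairing w'.
Proof.
rewrite scaler_sumr -big_split; apply: eq_bigr => a _ /=.
rewrite scaler_sumr -big_split; apply: eq_bigr => b _ /=.
by rewrite (osc_gen_linear a) scalerDr !scalerA [k * _]mulrC.
Qed.

Lemma osc_pairing0 w : (forall a, w a = 0) -> osc_pairing w = 0.
Proof.
move=> w0; rewrite /osc_pairing big1 // => a _; rewrite big1 // => b _.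
by rewrite w0 (lin0 (osc_gen_linear a)) scaler0.
Qed.

Lemma eq_osc_pairing w w' : w =1 w' -> osc_pairing w = osc_pairing w'.
Proof. by move=> ww'; do 2!apply: eq_bigr => ? _; rewrite ww'. Qed.

Lemma osc_pairingZ k w : osc_pairing (fun a => k *: w a) = k *: osc_pairing w.
Proof.
rewrite -[RHS]addr0 -[0](osc_pairing0 (w := fun=> 0)) // -osc_pairing_lin.
by apply: eq_osc_pairing => a; rewrite addr0.
Qed.

Lemma pol_sgn_osc_pairing w :
  pol_sgn (osc_pairing w) = - osc_pairing (fun a => pol_sgn (w a)).
Proof.
rewrite linear_sum -sumrN; apply: eq_bigr => a _ /=.
rewrite linear_sum -sumrN; apply: eq_bigr => b _ /=.
by rewrite linearZ /= pol_sgn_osc_gen scalerN.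
Qed.

(** Moving q_a to the left costs the commutators [q_c, q_a] = J_ca / 2. Contracted with J_cb they
    give w_a / 2, because J^T J = 1. *)
Lemma osc_gen_pairing a w :
  osc_pairing (fun b => osc_gen a (w b)) =
  osc_gen a (osc_pairing w) + 2^-1 *: w a.
Proof.
rewrite /osc_pairing linear_sum.
have -> : w a = \sum_c \sum_b J c b *: (J c a *: w b).
  rewrite exchange_big (bigD1 a) //= [X in _ + X]big1 ?addr0 => [|b ba].
    under eq_bigr do rewrite scalerA.
    by rewrite -scaler_suml sum_sympJ_sympJ eqxx scale1r.
  under eq_bigr do rewrite scalerA.
  by rewrite -scaler_suml sum_sympJ_sympJ (negPf ba) scale0r.
rewrite scaler_sumr -big_split; apply: eq_bigr => c _.
rewrite linear_sum scaler_sumr -big_split; apply: eq_bigr => b _ /=.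
rewrite osc_ccr (linZ (osc_gen_linear a) (J c b)) scalerDr; congr (_ + _).
by rewrite !scalerA mulrCA mulrA.
Qed.

(** The contraction is a sum of n commutators [q_i, q_(n+i)], each equal to 1/2. *)
Lemma osc_pairing_gen f : osc_pairing (fun a => osc_gen a f) = (n%:R / 2) *: f.
Proof.
rewrite osc_pairingE -sumrB.
under eq_bigr do rewrite osc_ccr addrC addKr sympJ_LR eqxx mulr1.
by rewrite sumr_const card_ord scalerMnl -mulr_natl.
Qed.

Lemma osc_pairing_sympJ f a :
  osc_pairing (fun b => J b a *: f) = - osc_gen a f.
Proof.
rewrite /osc_pairing.
under eq_bigr => c _ do under eq_bigr do rewrite (linZ (osc_gen_linear c)) scalerA.
under eq_bigr do rewrite -scaler_suml.
have JJ c : \sum_b J c b * J b a = - (c == a)%:R.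
  by transitivity ((J *m J) c a); [rewrite mxE|rewrite sympJK !mxE].
under eq_bigr do rewrite JJ.
rewrite (bigD1 a) //= big1 => [|c ca]; first by rewrite eqxx scaleN1r addr0.
by rewrite (negPf ca) oppr0 scale0r.
Qed.

(** * The images of the two Gamma operators as graphs *)

Definition Gamma_odd u : tens C n :=
  sqrtC 2 *: \sum_i stensor true ( *%R 'X_i) (Xneg C i) u
  - sqrtC 2 *: \sum_i stensor true (mderiv i) (Xpos C i) u.

Lemma Gamma1E u : Gamma1 u = u + Gamma_odd u.
Proof. by rewrite /Gamma1 /Gamma_odd addrA addrAC. Qed.

Lemma Gamma2E u : Gamma2 u = u - Gamma_odd u.
Proof. by rewrite /Gamma2 /Gamma_odd opprB addrA. Qed.

(** The factor sqrt 2 in Gamma and the 1 / sqrt 2 in q_a combine into the 2 of the graph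
    equations. *)
Lemma sqrtC2_osc_genL (i : 'I_n) f : sqrtC 2 *: f^`M(i) = 2 *: osc_gen (lshift n i) f.
Proof.
rewrite /osc_gen -[lshift n i]/(unsplit (inl i)) unsplitK scalerA -[X in X / _]sqrtCK.
by rewrite expr2 mulfK // sqrtC_eq0 pnatr_eq0.
Qed.

Lemma sqrtC2_osc_genR (i : 'I_n) f : sqrtC 2 *: ('X_i * f) = 2 *: osc_gen (rshift n i) f.
Proof.
rewrite /osc_gen -[rshift n i]/(unsplit (inr i)) unsplitK scalerA -[X in X / _]sqrtCK.
by rewrite expr2 mulfK // sqrtC_eq0 pnatr_eq0.
Qed.

Lemma Gamma_odd_v0 u :
  Gamma_odd u v0 = - 2 *: osc_pairing (fun a => pol_sgn (u (vodd a))).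
Proof.
rewrite osc_pairingE scaleNr -scalerN opprB scalerBr !ffunE !sum_ffunE.
rewrite !scaler_sumr; congr (_ - _); apply: eq_bigr => i _; rewrite ffunE.
  by rewrite Xneg_odd_osp odd_osp_sum_v0 sqrtC2_osc_genR.
by rewrite Xpos_odd_osp odd_osp_sum_v0 sqrtC2_osc_genL.
Qed.

Lemma Gamma_odd_vodd u a :
  Gamma_odd u (vodd a) = - 2 *: osc_gen a (pol_sgn (u v0)).
Proof.
rewrite !ffunE !sum_ffunE !scaler_sumr.
under eq_bigr => i _.
  rewrite ffunE Xneg_odd_osp odd_osp_sum_vodd scalerA mulrC -scalerA sqrtC2_osc_genR.
over.
under [X in _ - X]eq_bigr => i _.
  rewrite ffunE Xpos_odd_osp odd_osp_sum_vodd scalerA mulrC -scalerA sqrtC2_osc_genL.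
over.
(* Only one term survives: for a = j the derivative along j, with J = 1 and an outer minus sign; for
   a = n + j the multiplication by x_j, with J = -1. Both give the coefficient -2. *)
rewrite /= -[a]splitK; case: (split a) => j /=.
  rewrite big1 => [|i _]; last by rewrite sympJ_LL scale0r.
  rewrite (bigD1 j) //= big1 => [|i ij]; rewrite sympJ_LR.
    by rewrite eqxx scale1r addr0 sub0r scaleNr.
  by rewrite eq_sym (negPf ij) scale0r.
rewrite [X in _ - X]big1 => [|i _]; last by rewrite sympJ_RR scale0r.
rewrite (bigD1 j) //= big1 => [|i ij]; rewrite sympJ_RL.
  by rewrite eqxx scaleN1r addr0 subr0 scaleNr.
by rewrite eq_sym (negPf ij) oppr0 scale0r.
Qed.

Lemma tens_eqP u (v : tens C n) : u v0 = v v0 -> (forall a, u (vodd a) = v (vodd a)) -> u = v.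
Proof. by move=> uv0 uvodd; apply/ffunP => k; have [->|[a ->]] := split_v0_vodd k. Qed.

(** [Gamma_odd] exchanges the even and odd fibers, so on the odd fiber [Gamma1] fixes the odd
    coordinates and fills in the one along v_0. *)
Lemma Gamma1_imageP u :
  W1 u <-> u v0 = - 2 *: osc_pairing (fun a => pol_sgn (u (vodd a))).
Proof.
split=> [[w w0 <-]|u0].
  rewrite Gamma1E tensD Gamma_odd_v0 [w v0]w0 add0r; congr (_ *: _).
  apply: eq_osc_pairing => a.
  by rewrite tensD Gamma_odd_vodd [w v0]w0 !linear0 addr0.
(* The only possible preimage: u with its v_0 coordinate erased. *)
pose w : tens C n := [ffun k => if k == v0 then 0 else u k].
have w0 : w v0 = 0 by rewrite ffunE eqxx.
have wodd a : w (vodd a) = u (vodd a) by rewrite ffunE /v0 eq_rlshift.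
exists w => //; rewrite Gamma1E; apply: tens_eqP => [|a]; rewrite tensD.
  rewrite w0 add0r Gamma_odd_v0 u0; congr (_ *: _).
  by apply: eq_osc_pairing => a; rewrite wodd.
by rewrite Gamma_odd_vodd w0 !linear0 addr0 wodd.
Qed.

(** With the roles of the fibers exchanged, the v_0 coordinate is kept and determines the others;
    the sign is opposite since [Gamma2] subtracts [Gamma_odd]. *)
Lemma Gamma2_imageP u :
  W2 u <-> forall a, u (vodd a) = 2 *: osc_gen a (pol_sgn (u v0)).
Proof.
split=> [[w weven <-] a|uodd].
  have wodd b : w (vodd b) = 0 by apply: weven; rewrite /vpar /v0 eq_rlshift.
  have GammaD k : (w - Gamma_odd w) k = w k - Gamma_odd w k by rewrite !ffunE.
  rewrite Gamma2E !GammaD wodd add0r Gamma_odd_vodd Gamma_odd_v0 scaleNr opprK.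
  by rewrite osc_pairing0 ?scaler0 ?addr0 ?subr0 // => b; rewrite wodd linear0.
pose w : tens C n := [ffun k => if k == v0 then u v0 else 0].
have w0 : w v0 = u v0 by rewrite ffunE eqxx.
have wodd a : w (vodd a) = 0 by rewrite ffunE /v0 eq_rlshift.
have GammaD k : (w - Gamma_odd w) k = w k - Gamma_odd w k by rewrite !ffunE.
exists w => [k|]; first by rewrite /vpar ffunE => /negPf ->.
rewrite Gamma2E; apply: tens_eqP => [|a]; rewrite GammaD.
  by rewrite Gamma_odd_v0 w0 osc_pairing0 ?scaler0 ?subr0 // => b; rewrite wodd linear0.
by rewrite Gamma_odd_vodd w0 wodd uodd add0r scaleNr opprK.
Qed.


(** * The images are graded subspaces *)

Lemma subspace_Gamma1 : subspace W1.
Proof.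
split=> [|k u v /Gamma1_imageP u0 /Gamma1_imageP v0E]; apply/Gamma1_imageP.
  by rewrite osc_pairing0 ?ffunE ?scaler0 // => a; rewrite ffunE linear0.
have linE l : (k *: u + v) l = k *: u l + v l by rewrite !ffunE.
rewrite linE u0 v0E; under [in RHS]eq_osc_pairing => a do rewrite linE linearP.
by rewrite osc_pairing_lin scalerDr !scalerA mulrC.
Qed.

Lemma subspace_Gamma2 : subspace W2.
Proof.
split=> [|k u v /Gamma2_imageP uP /Gamma2_imageP vP]; apply/Gamma2_imageP => a.
  by rewrite !ffunE linear0 (lin0 (osc_gen_linear a)) scaler0.
have linE l : (k *: u + v) l = k *: u l + v l by rewrite !ffunE.
by rewrite !linE uP vP pol_sgn_linear osc_gen_linear scalerDr (scalerA k) (scalerA 2 k) mulrC.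
Qed.

(** The parity involution of the tensor product; its eigenvectors for 1 and -1 are the even and odd
    vectors. *)
Definition tens_sgn u : tens C n := [ffun k => (-1) ^+ vpar k *: pol_sgn (u k)].

Lemma tens_sgn_v0 u : tens_sgn u v0 = pol_sgn (u v0).
Proof. by rewrite ffunE /vpar eqxx scale1r. Qed.

Lemma tens_sgn_vodd u a : tens_sgn u (vodd a) = - pol_sgn (u (vodd a)).
Proof. by rewrite ffunE /vpar /v0 eq_rlshift scaleN1r. Qed.

Lemma tens_sgn_par (q : bool) u : tens_sgn u = (-1) ^+ q *: u -> tens_par q u.
Proof.
move=> /ffunP uq k; apply/pol_sgn_par; have := uq k; rewrite !ffunE => uk.
by rewrite signr_addb [_ * (-1) ^+ vpar k]mulrC -scalerA -uk scalerA -expr2 sqrr_sign scale1r.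
Qed.

Lemma tens_sgnK : involutive tens_sgn.
Proof.
move=> u; apply: tens_eqP => [|a]; first by rewrite !tens_sgn_v0 pol_sgnK.
by rewrite !tens_sgn_vodd linearN /= opprK pol_sgnK.
Qed.

Lemma tens_sgnD u (v : tens C n) : tens_sgn (u + v) = tens_sgn u + tens_sgn v.
Proof. by apply/ffunP => k; rewrite !ffunE linearD scalerDr. Qed.

Lemma tens_sgnZ x u : tens_sgn (x *: u) = x *: tens_sgn u.
Proof. by apply/ffunP => k; rewrite !ffunE linearZ /= !scalerA mulrC. Qed.

(** The homogeneous components are (u + s u) / 2 and (u - s u) / 2 for the parity involution s, so
    they stay in W. *)
Lemma graded_tens_sgn (W : set (tens C n)) :
  subspace W -> (forall u, W u -> W (tens_sgn u)) -> graded (@tens_par C n) W.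
Proof.
move=> [W0 Wlin] Wsgn u Wu.
have Whalf x : W (2^-1 *: (u + x *: tens_sgn u)).
  rewrite -[_ *: _]addr0; apply: (Wlin) => //; rewrite addrC; apply: Wlin => //.
  exact: Wsgn.
exists (2^-1 *: (u + 1 *: tens_sgn u)), (2^-1 *: (u + (-1) *: tens_sgn u)); split=> //.
- by apply: tens_sgn_par; rewrite tens_sgnZ tens_sgnD tens_sgnZ tens_sgnK !scale1r addrC.
- apply: tens_sgn_par; rewrite tens_sgnZ tens_sgnD tens_sgnZ tens_sgnK !scaleN1r.
  by rewrite -scalerN opprB addrC.
rewrite -scalerDr addrACA -scalerDl subrr scale0r addr0 -mulr2n -scaler_nat.
by rewrite scalerA mulVf ?scale1r // pnatr_eq0.
Qed.

(** The graph equation is preserved by the parity involution: the sign from its anticommutation with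
    q_a cancels the sign carried by the odd basis vectors. *)
Lemma graded_Gamma1 : graded (@tens_par C n) W1.
Proof.
apply: graded_tens_sgn subspace_Gamma1 _ => u /Gamma1_imageP u0; apply/Gamma1_imageP.
rewrite tens_sgn_v0 u0 linearZ /= pol_sgn_osc_pairing -scaleN1r -osc_pairingZ.
congr (_ *: _); apply: eq_osc_pairing => a.
by rewrite tens_sgn_vodd linearN /= scaleN1r.
Qed.

Lemma graded_Gamma2 : graded (@tens_par C n) W2.
Proof.
apply: graded_tens_sgn subspace_Gamma2 _ => u /Gamma2_imageP uP; apply/Gamma2_imageP => a.
by rewrite tens_sgn_v0 tens_sgn_vodd uP linearZ /= pol_sgn_osc_gen scalerN opprK.
Qed.

(** * Invariance under the odd generators *)

Section Action.
Variable rho : 'M[C]_(1 + (n + n)) -> pol C n -> pol C n.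
Hypothesis rhoP : oscillator rho.
Local Notation X a := (odd_osp (delta_mx 0 a)).

(** The row vectors e_j and e_(n+j) correspond to X_(-j) and X_j, where [oscillator] prescribes the
    action. *)
Lemma rho_odd_osp a f : rho (X a) f = osc_gen a f.
Proof.
have [_ rho_pos rho_neg] := rhoP.
rewrite /osc_gen -{1}[a]splitK; case: (split a) => j /=.
  by rewrite -Xneg_odd_osp rho_neg.
by rewrite -Xpos_odd_osp rho_pos.
Qed.

Lemma odd_osp_act_v0 a u :
  tensor_act rho (X a) u v0 = osc_gen a (u v0) + pol_sgn (u (vodd a)).
Proof.
by rewrite (tensor_actE _ _ _ (odd_osp_par _)) rho_odd_osp odd_osp_sum_v0.
Qed.

Lemma odd_osp_act_vodd a b u :
  tensor_act rho (X a) u (vodd b) = osc_gen a (u (vodd b)) + J b a *: pol_sgn (u v0).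
Proof.
by rewrite (tensor_actE _ _ _ (odd_osp_par _)) rho_odd_osp odd_osp_sum_vodd.
Qed.

(** With w_b = s u_b and p the pairing of w, so u_0 = -2 p, both sides become -2 q_a p + w_a; the
    term w_a on the right is the commutator term of [osc_gen_pairing]. *)
Lemma Gamma1_image_invariant a u : W1 u -> W1 (tensor_act rho (X a) u).
Proof.
move=> /Gamma1_imageP u0; apply/Gamma1_imageP; rewrite odd_osp_act_v0.
pose w b := pol_sgn (u (vodd b)).
have wE b : pol_sgn (tensor_act rho (X a) u (vodd b)) =
    -1 *: osc_gen a (w b) + J b a *: u v0.
  by rewrite odd_osp_act_vodd addrC pol_sgn_linear pol_sgnK pol_sgn_osc_gen addrC scaleN1r.
rewrite (eq_osc_pairing wE) osc_pairing_lin osc_gen_pairing osc_pairing_sympJ.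
rewrite -/(w a) u0 -/w (linZ (osc_gen_linear a)).
(* Comparing coefficients of each monomial leaves a scalar identity. *)
move: (osc_gen a _) (w a) => f g; apply/mpolyP => m; rewrite !(mcoeffD, mcoeffZ, mcoeffN).
by field.
Qed.

(** Applying s to the new v_0 coordinate gives q_a s u_0; what remains is [q_b, q_a] = J_ba / 2
    applied to s u_0. *)
Lemma Gamma2_image_invariant a u : W2 u -> W2 (tensor_act rho (X a) u).
Proof.
move=> /Gamma2_imageP uP; apply/Gamma2_imageP => b.
rewrite odd_osp_act_v0 odd_osp_act_vodd !uP.
have -> : pol_sgn (osc_gen a (u v0) + pol_sgn (2 *: osc_gen a (pol_sgn (u v0)))) =
    osc_gen a (pol_sgn (u v0)).
  by rewrite (linD (@pol_sgn_linear C n)) pol_sgnK pol_sgn_osc_gen scaler_nat mulr2n addKr.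
rewrite (linZ (osc_gen_linear a)) (osc_ccr b a) scalerDr; congr (_ + _).
by rewrite scalerA mulrA mulfV ?mul1r // pnatr_eq0.
Qed.

Lemma osp_submodule_Gamma1 : osp_submodule (@tens_par C n) (tensor_act rho) W1.
Proof.
split; [exact: subspace_Gamma1|exact: graded_Gamma1|].
apply: osp_invariant_odd (tensor_act_rep _) subspace_Gamma1 Gamma1_image_invariant.
by case: rhoP.
Qed.

Lemma osp_submodule_Gamma2 : osp_submodule (@tens_par C n) (tensor_act rho) W2.
Proof.
split; [exact: subspace_Gamma2|exact: graded_Gamma2|].
apply: osp_invariant_odd (tensor_act_rep _) subspace_Gamma2 Gamma2_image_invariant.
by case: rhoP.
Qed.

End Action.

(** * Complementarity of the two graphs *)

(* On [W2] the pairing that defines [W1] acts as the scalar [2n != 1]: this is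
   the sum of the canonical commutators [[d/dx_i, x_i]], and gives W1 (+) W2. *)
Lemma Gamma2_image_pairing u : W2 u ->
  - 2 *: osc_pairing (fun a => pol_sgn (u (vodd a))) = (n%:R *+ 2) *: u v0.
Proof.
move=> /Gamma2_imageP uP.
have wE a : pol_sgn (u (vodd a)) = -2 *: osc_gen a (u v0).
  by rewrite uP linearZ /= pol_sgn_osc_gen pol_sgnK scalerN scaleNr.
rewrite (eq_osc_pairing wE) osc_pairingZ osc_pairing_gen !scalerA.
by congr (_ *: _); field.
Qed.

Lemma direct_sum_Gamma : internal_direct_sum W1 W2.
Proof.
(* In characteristic 0 it suffices that 2n is even and 1 is odd. *)
have nz : 1 - n%:R *+ 2 != 0 :> C.
  rewrite subr_eq0 -mulr_natr -natrM -[1]/(1%:R) eqr_nat.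
  by apply/eqP => /(congr1 odd); rewrite oddM andbF.
split=> [u|]; last first.
  apply/seteqP; split=> [u [/Gamma1_imageP u0 W2u]|_ ->]; last first.
    by split; [case: subspace_Gamma1|case: subspace_Gamma2].
  (* In the intersection u_0 = 2n u_0, hence u_0 = 0, and the equations of W2 then annihilate the
     odd coordinates. *)
  have uv0 : u v0 = 0.
    apply/eqP; have /eqP := u0; rewrite (Gamma2_image_pairing W2u) -subr_eq0.
    by rewrite -{1}[u v0]scale1r -scalerBl scaler_eq0 (negPf nz).
  move/Gamma2_imageP: W2u => uP; apply: tens_eqP => [|a]; rewrite [RHS]ffunE //.
  by rewrite uP uv0 linear0 (lin0 (osc_gen_linear a)) scaler0.
pose phi := - 2 *: osc_pairing (fun a => pol_sgn (u (vodd a))).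
(* If f is the v_0 coordinate of the W2 component, the W1 equation for the difference reads u_0 - f
   = phi - 2n f; solve for f. *)
pose f := (1 - n%:R *+ 2)^-1 *: (u v0 - phi).
pose u2 : tens C n :=
  [ffun k => if split k is inr a then 2 *: osc_gen a (pol_sgn f) else f].
have u2v0 : u2 v0 = f by rewrite ffunE -[v0]/(unsplit (inl ord0)) unsplitK.
have u2odd a : u2 (vodd a) = 2 *: osc_gen a (pol_sgn f).
  by rewrite ffunE -[vodd a]/(unsplit (inr a)) unsplitK.
have W2u2 : W2 u2 by apply/Gamma2_imageP => a; rewrite u2odd u2v0.
exists (u - u2), u2; split=> //; last by rewrite subrK.
have subE l : (u - u2) l = -1 *: u2 l + u l by rewrite !ffunE addrC scaleN1r.
apply/Gamma1_imageP; under eq_osc_pairing => a do rewrite subE pol_sgn_linear.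
rewrite osc_pairing_lin scalerDr scalerA mulrC -scalerA (Gamma2_image_pairing W2u2) -/phi.
rewrite subE u2v0 /f; move: (phi) => p; apply/mpolyP => m; rewrite !(mcoeffD, mcoeffZ, mcoeffN).
by field; rewrite mulr_natr.
Qed.

End Gamma.

Theorem corollary1p3 (R : realType) (n : nat) (hn : (1 < n)%N)
    (rho : 'M[R[i]]_(1 + (n + n)) -> pol R[i] n -> pol R[i] n)
    (hrho : oscillator rho) :
  let W1 := @Gamma1 R[i] n @` @tens_odd_fiber R[i] n in
  let W2 := @Gamma2 R[i] n @` @tens_even_fiber R[i] n in
  [/\ osp_submodule (@tens_par R[i] n) (tensor_act rho) W1,
      osp_submodule (@tens_par R[i] n) (tensor_act rho) W2 &
      internal_direct_sum W1 W2].
Proof.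
move=> W1 W2; split; first exact: osp_submodule_Gamma1.
- exact: osp_submodule_Gamma2.
- exact: direct_sum_Gamma.
Qed.
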